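(* Let $K$ be a commutative field of characteristic $\neq 2$. For all integers $p,q\ge2$ and $r,s\ge0$ put \begin{align*} E^{[n]}_{p,q}(x)&=x^px^q-x^{p+1}-x^{q+1}+x^2,\\ E^{[n,1]}_{p,q}(x,y)&=x^p(x^qy)-x(xy)-x^py-x^{q+1}y+x^2y+xy,\\ E^{[n,1]}_{p,\{r\}}(x,y)&=x^p(x^{\{r\}}y)-x^py-x^{\{r+1\}}y+xy,\\ E^{[n,1]}_{\{r\},p}(x,y)&=x^{\{r\}}(x^py)-x^{\{r+1\}}y-x^{p+r}y+x^{r+1}y,\\ E^{[n,2]}_{p,\{r\}}(x,y)&=x^p\bigl((x^{\{r\}}y)y\bigr)-2(x^{\{p-1\}}y)y-(x^{\{r+1\}}y)y+x^{\{p-1\}}y^2+(xy)y-xy^2+y^2,\\ E^{[n,2]}_{\{r\},\{s\}}(x,y)&=x^{\{r\}}\bigl((x^{\{s\}}y)y\bigr)-(x^{\{r+s\}}y)y+(x^{\{r\}}y)y-x^{\{r\}}y^2,\\ F^{[n,2]}_{p,\{r\}}(x,y)&=x^p(x^{\{r\}}y^2)-2(x^{\{p-1\}}y)y+x^{\{p-1\}}y^2-x^{\{r+1\}}y^2+y^2,\\ G^{[n,2]}_{p,q}(x,y)&=(x^py)(x^qy)-2(x^{\{p\}}y)y-2(x^{\{q\}}y)y+x^{\{p\}}y^2+x^{\{q\}}y^2+2(xy)y-2xy^2+y^2,\\ G^{[n,2]}_{p,\{r\}}(x,y)&=(x^py)(x^{\{r\}}y)-2(x^{\{p\}}y)y-(x^{\{r\}}y)y+x^{\{p\}}y^2+(xy)y-xy^2+y^2,\\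 G^{[n,2]}_{\{r\},\{s\}}(x,y)&=(x^{\{r\}}y)(x^{\{s\}}y)-(x^{\{r\}}y)y-(x^{\{s\}}y)y+y^2 . \end{align*} Let $\mathscr G$ be the ideal generated by the family of all these polynomials ($p,q\ge2$, $r,s\ge0$) and let $\pi:K(x,y)\to K(x,y)/\mathscr G$ be the canonical surjection. Then for every $n\ge2$ and every monomial $w\in\mathfrak M(x,y)_{[n,2]}$ such that $w\ne(x^{\{n\}}y)y$ and $w\neq x^{\{n\}}y^2$ one has $\pi(w)=P_w$, and for every $f\in\bigoplus_{n\ge2}K(x,y)_{[n,2]}$ the polynomial $f-\pi(f)$ is an evanescent train identity. Here $\mathscr F=\{(x^{\{r\}}y)y,\ x^{\{r\}}y^2 : r\ge0\}$ and, for such $w$, $P_w$ denotes the unique polynomial of $\mathbb Q\langle\mathscr F\rangle$ with $|P_w|_x\le n$ such that $w-P_w$ is an evanescent train identity.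
   Context: $\mathfrak M(x,y)$ is the set of commutative nonassociative monomials in the letters $x,y$ (free commutative magma); $K(x,y)$ is the free commutative nonassociative $K$-algebra with basis $\mathfrak M(x,y)$. A monomial has type $[a,b]$ if $x$ occurs $a$ times and $y$ occurs $b$ times; $\mathfrak M(x,y)_{[a,b]}$ is the set of monomials of type $[a,b]$ and $K(x,y)_{[a,b]}$ its span; a polynomial is homogeneous if all its monomials have the same type; $|f|_x$ (resp. $|f|_y$) is the maximal number of occurrences of $x$ (resp. $y$) in the monomials of $f$. $K$ is assumed to satisfy $\operatorname{card}K^*>\max(|f|_x,|f|_y)$ for the polynomials $f$ considered. Principal powers: $x^1=x$, $x^{k+1}=x\,x^k$, and $y^2=yy$. For a polynomial $g$: $x^{\{0\}}g=g$, $x^{\{r\}}g=x\,(x^{\{r-1\}}g)$. $\mathbb Q\langle\mathscr F\rangle$ is the $\mathbb Q$-vector space spanned by $\mathscr F$. In the expressions $\pi(w)=P_w$ and $f-\pi(f)$, the class $\pi(f)$ is written as a linear combination of elements of $\mathscr F$, obtained by reducing $f$ modulo the generators of $\mathscr G$. For a letter $a$, $\partial_a:K(x,y)\to K[t]$ is the linear map with $\partial_a(a)=1$, $\partial_a(b)=0$ for a letter $b\ne a$, and $\partial_a(uv)=t(\partial_au+\partial_av)$ for monomials $u,v$. A polynomial $f$ is an evanescent identity if $f\ne0$, $\partial_xf=\partial_yf=0$ and $f(1,1)=0$, where $f(1,1)$ is the sum of the coefficients of $f$. A train polynomial of degree $(n,2)$ is a non-homogeneous polynomial $f=g-\sum_{i=1}^rh_i$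 with $f(1,1)=0$, $g$ homogeneous of type $[n,2]$, and each $h_i$ homogeneous of type $[\delta_i,2]$, where $0\le\delta_1<\dots<\delta_r<n$. An evanescent train identity is a train polynomial that is an evanescent identity.
   Formalization: The last clause fails when f−π(f) is zero (e.g. f=(x^{2}y)y) or homogeneous; it is proved as: f−π(f) is an evanescent identity if it is nonzero, and an evanescent train identity if it is not homogeneous. *)

(* Defs.v *)
From HB Require Import structures.
From mathcomp Require Import all_boot all_order all_algebra finmap.
From mathcomp.multinomials Require Import monalg.

Set Implicit Arguments.
Unset Strict Implicit.
Unset Printing Implicit Defensive.

Import GRing.Theory.

Declare Scope magma_scope.
Delimit Scope magma_scope with mg.

(* The free commutative magma on x, y.  A monomial is represented by the
   binary tree in which the two sons of every node are listed in increasing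
   order for a fixed (arbitrary) total order on trees, here the one given by
   an enumeration of all trees; see mmulC, mmul_eq and monomial_ind. *)

Inductive letter := lx | ly.

Definition bool_of_letter a := if a is lx then true else false.
Definition letter_of_bool (b : bool) := if b then lx else ly.
Lemma bool_of_letterK : cancel bool_of_letter letter_of_bool.
Proof. by case. Qed.
HB.instance Definition _ := Countable.copy letter (can_type bool_of_letterK).

Inductive tree := Leaf of letter | Node of tree & tree.

Fixpoint tree_encode (t : tree) : GenTree.tree letter :=
  match t with
  | Leaf a => GenTree.Leaf a
  | Node u v => GenTree.Node 0 [:: tree_encode u; tree_encode v]
  end.

Fixpoint tree_decode (g : GenTree.tree letter) : option tree :=
  match g with
  | GenTree.Leaf a => Some (Leaf a)
  | GenTree.Node _ [:: g1; g2] =>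
      if (tree_decode g1, tree_decode g2) is (Some u, Some v)
      then Some (Node u v) else None
  | _ => None
  end.

Lemma tree_encodeK : pcancel tree_encode tree_decode.
Proof. by elim=> //= u -> v ->. Qed.
HB.instance Definition _ := Countable.copy tree (pcan_type tree_encodeK).

Definition tree_le (u v : tree) : bool := (choice.pickle u <= choice.pickle v)%N.

Fixpoint canonical (t : tree) : bool :=
  if t is Node u v then [&& canonical u, canonical v & tree_le u v] else true.

Record monomial := Monomial { tree_of : tree; tree_ofP : canonical tree_of }.
HB.instance Definition _ := [isSub for tree_of].
HB.instance Definition _ := [Countable of monomial by <:].

Definition var (a : letter) : monomial := @Monomial (Leaf a) isT.
Notation vx := (var lx).
Notation vy := (var ly).

Definition mnode (u v : tree) : tree :=
  if tree_le u v then Node u v else Node v u.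

Lemma mnode_canonical u v : canonical u -> canonical v -> canonical (mnode u v).
Proof.
rewrite /mnode /tree_le => cu cv.
by case: leqP => [le|/ltnW le] /=; rewrite cu cv /tree_le le.
Qed.

Definition mmul (u v : monomial) : monomial :=
  Monomial (mnode_canonical (tree_ofP u) (tree_ofP v)).

Notation "u ** v" := (mmul u v)
  (at level 40, left associativity) : magma_scope.
Local Open Scope magma_scope.

Lemma mnodeC u v : mnode u v = mnode v u.
Proof.
rewrite /mnode /tree_le; case: ltngtP => // /(pcan_inj choice.pickleK) ->.
by [].
Qed.

Lemma mmulC : commutative mmul.
Proof. by move=> u v; apply/val_inj/mnodeC. Qed.

Lemma mmul_eq u v u' v' :
  u ** v = u' ** v' -> (u = u' /\ v = v') \/ (u = v' /\ v = u').
Proof.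
move/(congr1 tree_of); rewrite /= /mnode.
by case: tree_le; case: tree_le => -[/val_inj-> /val_inj->]; auto.
Qed.

Lemma var_neq_mmul a u v : var a <> u ** v.
Proof. by move/(congr1 tree_of); rewrite /= /mnode; case: tree_le. Qed.

Lemma monomial_ind (P : monomial -> Prop) :
  (forall a, P (var a)) -> (forall u v, P u -> P v -> P (u ** v)) ->
  forall m, P m.
Proof.
move=> Pvar Pmul [t ct]; elim: t ct => [a|u IHu v IHv] ct.
  by rewrite (_ : Monomial ct = var a) //; apply/val_inj.
have /and3P[cu cv le] := ct.
rewrite (_ : Monomial ct = Monomial cu ** Monomial cv); first exact: Pmul.
by apply/val_inj; rewrite /= /mnode le.
Qed.

(* Number of occurrences of a letter, and type [a,b] of a monomial. *)

Fixpoint tree_occ (a : letter) (t : tree) : nat :=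
  match t with
  | Leaf b => (b == a : nat)
  | Node u v => (tree_occ a u + tree_occ a v)%N
  end.
Definition occ (a : letter) (m : monomial) : nat := tree_occ a (tree_of m).

Lemma occ_mul a u v : occ a (u ** v) = (occ a u + occ a v)%N.
Proof. by rewrite /occ /= /mnode; case: tree_le; rewrite //= addnC. Qed.

Definition of_type (a b : nat) (m : monomial) : Prop :=
  occ lx m = a /\ occ ly m = b.

(* xpow k is x^k (for k >= 1), and xbr r m is x^{r} m. *)
Definition xpow (k : nat) : monomial := iter k.-1 (mmul vx) vx.
Definition xbr (r : nat) (m : monomial) : monomial := iter r (mmul vx) m.

Lemma xpowS k : (0 < k)%N -> xpow k.+1 = vx ** xpow k.
Proof. by case: k. Qed.

Definition FF (m : monomial) : Prop :=
  exists r : nat, m = xbr r vy ** vy \/ m = xbr r (vy ** vy).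

Local Open Scope ring_scope.

(* K(x,y), with product fmul below. *)
Notation freealg K := {malg K[monomial]}.

Section FreeAlgebra.
Variable K : fieldType.
Implicit Types f g h P : freealg K.

Definition mono (m : monomial) : freealg K := << m >>.

Definition fmul f g : freealg K :=
  \sum_(u <- msupp f) \sum_(v <- msupp g) << f@_u * g@_v *g u ** v >>.

(* The K-span of a set of monomials, see mspanP. *)
Definition mspan (S : monomial -> Prop) f : Prop :=
  forall m : monomial, m \in msupp f -> S m.

Definition homogeneous f : Prop := exists a b : nat, mspan (of_type a b) f.

Definition fdeg (a : letter) f : nat := \max_(m <- msupp f) occ a m.

Definition ev11 f : K := \sum_(m <- msupp f) f@_m.

(* The variable t of K[t] is 'X. *)
Fixpoint tree_der (a : letter) (t : tree) : {poly K} :=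
  match t with
  | Leaf b => (b == a)%:R
  | Node u v => 'X * (tree_der a u + tree_der a v)
  end.
Definition mder (a : letter) (m : monomial) : {poly K} := tree_der a (tree_of m).
Definition der (a : letter) f : {poly K} :=
  \sum_(m <- msupp f) f@_m *: mder a m.

Definition evanescent f : Prop :=
  [/\ f <> 0, der lx f = 0, der ly f = 0 & ev11 f = 0].

Definition train_polynomial (n : nat) f : Prop :=
  [/\ ~ homogeneous f, ev11 f = 0
    & exists (g : freealg K) (r : nat) (d : 'I_r -> nat) (h : 'I_r -> freealg K),
      [/\ g <> 0 /\ mspan (of_type n 2) g,
          forall i, mspan (of_type (d i) 2) (h i),
          forall i j : 'I_r, (i < j)%N -> (d i < d j)%N,
          forall i, (d i < n)%N
        & f = g - \sum_(i < r) h i]].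

Definition evanescent_train f : Prop :=
  (exists n : nat, train_polynomial n f) /\ evanescent f.

(* card K^* > max (|f|_x, |f|_y); K may be infinite. *)
Definition enough_scalars f : Prop :=
  exists s : seq K,
    [/\ uniq s, 0 \notin s & (maxn (fdeg lx f) (fdeg ly f) < size s)%N].

Definition is_ideal (I : freealg K -> Prop) : Prop :=
  [/\ I 0, forall f g, I f -> I g -> I (f + g),
      forall (c : K) f, I f -> I (c *: f)
    & forall f g, I f -> I (fmul f g)].

Definition ideal_generated (S : freealg K -> Prop) (f : freealg K) : Prop :=
  forall I, is_ideal I -> (forall g, S g -> I g) -> I f.

Local Notation "[[ m ]]" := (mono m%mg) (at level 0, m at level 99).
Local Notation x := vx.
Local Notation y := vy.
Local Notation y2 := (vy ** vy).

Definition E_n p q : freealg K :=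
  [[xpow p ** xpow q]] - [[xpow p.+1]] - [[xpow q.+1]] + [[xpow 2]].

Definition E_n1_pow_pow p q : freealg K :=
  [[xpow p ** (xpow q ** y)]] - [[x ** (x ** y)]] - [[xpow p ** y]]
  - [[xpow q.+1 ** y]] + [[xpow 2 ** y]] + [[x ** y]].

Definition E_n1_pow_br p r : freealg K :=
  [[xpow p ** xbr r y]] - [[xpow p ** y]] - [[xbr r.+1 y]] + [[x ** y]].

Definition E_n1_br_pow r p : freealg K :=
  [[xbr r (xpow p ** y)]] - [[xbr r.+1 y]] - [[xpow (p + r) ** y]]
  + [[xpow r.+1 ** y]].

Definition E_n2_pow_br p r : freealg K :=
  [[xpow p ** (xbr r y ** y)]] - 2 *: [[xbr p.-1 y ** y]]
  - [[xbr r.+1 y ** y]] + [[xbr p.-1 y2]] + [[(x ** y) ** y]]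
  - [[x ** y2]] + [[y2]].

Definition E_n2_br_br r s : freealg K :=
  [[xbr r (xbr s y ** y)]] - [[xbr (r + s) y ** y]] + [[xbr r y ** y]]
  - [[xbr r y2]].

Definition F_n2_pow_br p r : freealg K :=
  [[xpow p ** xbr r y2]] - 2 *: [[xbr p.-1 y ** y]] + [[xbr p.-1 y2]]
  - [[xbr r.+1 y2]] + [[y2]].

Definition G_n2_pow_pow p q : freealg K :=
  [[(xpow p ** y) ** (xpow q ** y)]] - 2 *: [[xbr p y ** y]]
  - 2 *: [[xbr q y ** y]] + [[xbr p y2]] + [[xbr q y2]]
  + 2 *: [[(x ** y) ** y]] - 2 *: [[x ** y2]] + [[y2]].

Definition G_n2_pow_br p r : freealg K :=
  [[(xpow p ** y) ** xbr r y]] - 2 *: [[xbr p y ** y]] - [[xbr r y ** y]]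
  + [[xbr p y2]] + [[(x ** y) ** y]] - [[x ** y2]] + [[y2]].

Definition G_n2_br_br r s : freealg K :=
  [[xbr r y ** xbr s y]] - [[xbr r y ** y]] - [[xbr s y ** y]] + [[y2]].

Inductive generator : freealg K -> Prop :=
| Gen_E_n p q : (2 <= p)%N -> (2 <= q)%N -> generator (E_n p q)
| Gen_E_n1_pow_pow p q :
    (2 <= p)%N -> (2 <= q)%N -> generator (E_n1_pow_pow p q)
| Gen_E_n1_pow_br p r : (2 <= p)%N -> generator (E_n1_pow_br p r)
| Gen_E_n1_br_pow r p : (2 <= p)%N -> generator (E_n1_br_pow r p)
| Gen_E_n2_pow_br p r : (2 <= p)%N -> generator (E_n2_pow_br p r)
| Gen_E_n2_br_br r s : generator (E_n2_br_br r s)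
| Gen_F_n2_pow_br p r : (2 <= p)%N -> generator (F_n2_pow_br p r)
| Gen_G_n2_pow_pow p q :
    (2 <= p)%N -> (2 <= q)%N -> generator (G_n2_pow_pow p q)
| Gen_G_n2_pow_br p r : (2 <= p)%N -> generator (G_n2_pow_br p r)
| Gen_G_n2_br_br r s : generator (G_n2_br_br r s).

Definition idealG : freealg K -> Prop := ideal_generated generator.

(* The elements of K(x,y)/G are the cosets of the ideal. *)
Definition piG (f : freealg K) : freealg K -> Prop := fun g => idealG (g - f).

(* P is the class piG f, written as a linear combination of elements of FF. *)
Definition reduced_form f P : Prop := mspan FF P /\ piG f = piG P.

End FreeAlgebra.

Arguments mono {K} m%_mg.

(* The polynomial P_w of Q<FF>; it is a polynomial over rat, whatever K is. *)
Definition is_Pw (n : nat) (w : monomial) (P : freealg rat) : Prop :=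
  [/\ mspan FF P, (fdeg lx P <= n)%N & evanescent_train (mono w - P)].

(* ratr c is the image of c in K only when the denominator of c is nonzero in
   K, which is what coefs_in states. *)
Definition coefs_in (K : fieldType) (P : freealg rat) : Prop :=
  forall m : monomial, (denq P@_m)%:~R != 0 :> K.
Definition base_change (K : fieldType) (P : freealg rat) : freealg K :=
  \sum_(m <- msupp P) << ratr P@_m *g m >>.

Section Facts.
Variable K : fieldType.
Implicit Types f g : freealg K.

Lemma mder_var a b : mder K a (var b) = (b == a)%:R.
Proof. by []. Qed.

Lemma mder_mul a u v : mder K a (u ** v) = 'X * (mder K a u + mder K a v).
Proof. by rewrite /mder /= /mnode; case: tree_le; rewrite //= addrC. Qed.

Lemma mspanP (S : monomial -> Prop) f :
  mspan S f <-> exists s : seq (K * monomial),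
    (forall p, p \in s -> S p.2) /\ f = \sum_(p <- s) p.1 *: mono p.2.
Proof.
split=> [Sf | [s [Ss ->]]].
  exists [seq (f@_m, m) | m <- msupp f]; split.
    by move=> p /mapP[m mf ->]; apply: Sf.
  rewrite big_map [LHS]monalgE; apply: eq_bigr => m _ /=.
  by apply/malgP => k; rewrite mcoeffZ !mcoeffU mulrnAr mulr1.
elim: s Ss => [|p s IHs] Ss m; first by rewrite big_nil msupp0.
rewrite big_cons => /(fsubsetP (msuppD_le _ _)); rewrite in_fsetU.
case/orP => [/(fsubsetP (msuppZ_le _ _)) | ].
  by rewrite msuppU oner_eq0 in_fset1 => /eqP->; apply: Ss; rewrite mem_head.
by apply: IHs => q qs; apply: Ss; rewrite inE qs orbT.
Qed.

Lemma fmulUU (u v : monomial) : fmul (mono u) (mono v) = mono (u ** v) :> freealg K.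
Proof.
rewrite /fmul !msuppU oner_eq0 !big_seq_fset1.
by rewrite !mcoeffU !eqxx mulr1.
Qed.

Lemma fmulC : commutative (@fmul K).
Proof.
move=> f g; rewrite /fmul exchange_big; apply: eq_bigr => v _.
by apply: eq_bigr => u _; rewrite mulrC mmulC.
Qed.

End Facts.

(* Main.v *)
From Stdlib Require Import FunctionalExtensionality PropExtensionality.
From HB Require Import structures.
Require Import Defs.
From mathcomp Require Import all_boot all_order all_algebra finmap.
From mathcomp.multinomials Require Import monalg.
From mathcomp Require Import ring zify.

(** The polynomials f with der x f = der y f = 0 and f(1,1) = 0 form an ideal,
    since der (f g) = t (g(1,1) der f + f(1,1) der g), and the generators of G
    lie in it.  In characteristic different from 2 this ideal meets the span of
    FF in 0 (compare the coefficients of t^(n+1), where n is the largest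
    x-degree), so a reduced form is unique.  It exists, with integer coefficients
    that do not depend on the field, because the generators rewrite a product of
    reduced monomials as a combination of reduced ones of no larger x-degree.
    Finally, for a monomial w of type [n,2] outside FF, w - P_w is not
    homogeneous: otherwise P_w = a (x^{n}y)y + b x^{n}y^2, and der y shows that
    the two leaves y of w have depths 1, n+1 or n+1, n+1; as n+1 is the largest
    depth possible, w is then one of the two excluded monomials. *)

Set Implicit Arguments.
Unset Strict Implicit.

Import GRing.Theory.
Local Open Scope ring_scope.

(** * Evanescence defines an ideal *)

Section LinearExtension.
Variables (K : fieldType) (V : lmodType K) (phi : monomial -> V).

(** The linear extension of [phi] from the basis of monomials. [der], [ev11] and [fmul] are all of
    this form, so their linearity is proved once. *)
Definition mlin (f : freealg K) : V := \sum_(m <- msupp f) f@_m *: phi m.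

Lemma mlinEw (d : {fset monomial}) f :
  (msupp f `<=` d)%fset -> mlin f = \sum_(m <- d) f@_m *: phi m.
Proof.
move=> le; rewrite /mlin; apply/esym; rewrite (big_fsetID _ (mem (msupp f))) /=.
rewrite [X in _ + X]big1_fset ?addr0; last first.
  move=> m; rewrite !inE => /andP[_ /mcoeff_outdom->] _; exact: scale0r.
apply: eq_fbigl => m; rewrite !inE andbC; case: (boolP (m \in _)) => //= hm.
by rewrite (fsubsetP le).
Qed.

Lemma mlin_is_linear : linear mlin.
Proof.
move=> c f g; pose d := (msupp f `|` msupp g)%fset.
have lf : (msupp f `<=` d)%fset by apply: fsubsetUl.
have lg : (msupp g `<=` d)%fset by apply: fsubsetUr.
have lh : (msupp (c *: f + g) `<=` d)%fset.
  by apply: fsubset_trans (msuppD_le _ _) _; apply/fsetSU/msuppZ_le.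
rewrite (mlinEw lf) (mlinEw lg) (mlinEw lh) scaler_sumr -big_split /=.
by apply: eq_bigr => m _; rewrite mcoeffD mcoeffZ scalerDl scalerA.
Qed.

HB.instance Definition _ :=
  GRing.isLinear.Build K (freealg K) V *:%R mlin mlin_is_linear.

Lemma mlin_mono m : mlin (mono m) = phi m.
Proof. by rewrite /mlin msuppU oner_eq0 big_seq_fset1 mcoeffUU scale1r. Qed.

End LinearExtension.

Arguments mlin {K V}.

Section FreeAlg.
Variable K : fieldType.
Implicit Types (f g h : freealg K) (m u v w : monomial).

Lemma der_mlin a f : der a f = mlin (mder K a) f.
Proof. by []. Qed.

Lemma ev11_mlin f : ev11 f = mlin (fun _ => 1 : K^o) f.
Proof. by apply: eq_bigr => m _; rewrite /GRing.scale /= mulr1. Qed.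

Lemma fmul_mlin f g :
  fmul f g = mlin (fun u => mlin (fun v => mono (u ** v)%mg) g) f.
Proof.
rewrite /fmul /mlin; apply: eq_bigr => u _; rewrite scaler_sumr.
apply: eq_bigr => v _; rewrite scalerA; apply/malgP => k.
by rewrite mcoeffZ !mcoeffU mulrnAr mulr1.
Qed.

Lemma monoE f : f = mlin mono f.
Proof.
rewrite [LHS]monalgE; apply: eq_bigr => m _ /=.
by apply/malgP => k; rewrite mcoeffZ !mcoeffU mulrnAr mulr1.
Qed.

Lemma mlin_comp (V W : lmodType K) (phi : monomial -> V) (L : {linear V -> W}) f :
  L (mlin phi f) = mlin (fun m => L (phi m)) f.
Proof. by rewrite linear_sum; apply: eq_bigr => m _; rewrite linearZ. Qed.

Lemma eq_mlin (V : lmodType K) (phi psi : monomial -> V) f :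
  phi =1 psi -> mlin phi f = mlin psi f.
Proof. by move=> e; apply: eq_bigr => m _; rewrite e. Qed.

Definition vanishing f : Prop := [/\ der lx f = 0, der ly f = 0 & ev11 f = 0].

(** Bilinear extension of [mder_mul]: summing over the monomials of [g] weights each [mder K a u] by
    [ev11 g], and symmetrically. *)
Lemma der_fmul a f g :
  der a (fmul f g) = 'X * (ev11 g *: der a f + ev11 f *: der a g).
Proof.
rewrite fmul_mlin !der_mlin mlin_comp.
pose A u := mlin (fun v => mder K a (u ** v)%mg) g.
rewrite (eq_mlin (psi := fun u => 'X * (ev11 g *: mder K a u + der a g))); last first.
  move=> u; rewrite mlin_comp /mlin /ev11 /der.
  rewrite scaler_suml -big_split mulr_sumr; apply: eq_bigr => v _ /=.
  by rewrite -/(mlin _ _) mlin_mono mder_mul -scalerDr scalerAr.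
rewrite -!der_mlin [ev11 f]/ev11 [der a f]/der [X in X + _]scaler_sumr scaler_suml.
rewrite -big_split mulr_sumr; apply: eq_bigr => u _ /=.
by rewrite scalerAr scalerDr !scalerA [ev11 g * _]mulrC.
Qed.

Lemma ev11_fmul f g : ev11 (fmul f g) = ev11 f * ev11 g.
Proof.
rewrite fmul_mlin ev11_mlin mlin_comp (eq_mlin (psi := fun=> ev11 g : K^o)).
  by rewrite [ev11 f]/ev11 mulr_suml.
by move=> u; rewrite mlin_comp ev11_mlin; apply: eq_mlin => v; exact: mlin_mono.
Qed.

Lemma vanishing0 : vanishing 0.
Proof. by split; rewrite ?der_mlin ?ev11_mlin linear0. Qed.

Lemma vanishingD f g : vanishing f -> vanishing g -> vanishing (f + g).
Proof.
rewrite /vanishing !der_mlin !ev11_mlin => -[a b c] [a' b' c'].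
by split; rewrite ?der_mlin ?ev11_mlin linearD /= ?a ?b ?c ?a' ?b' ?c' addr0.
Qed.

Lemma vanishingZ c f : vanishing f -> vanishing (c *: f).
Proof.
rewrite /vanishing !der_mlin !ev11_mlin => -[a b e].
by split; rewrite ?der_mlin ?ev11_mlin linearZ /= ?a ?b ?e scaler0.
Qed.

Lemma vanishing_fmul f g : vanishing f -> vanishing (fmul f g).
Proof.
move=> [a b c].
by split; rewrite ?der_fmul ?ev11_fmul ?a ?b c ?mul0r // scaler0 scale0r addr0 mulr0.
Qed.

Lemma vanishing_ideal : is_ideal vanishing.
Proof.
split; [exact: vanishing0 | exact: vanishingD | exact: vanishingZ |].
exact: vanishing_fmul.
Qed.
End FreeAlg.

(** * Evanescence of the generators *)

Section Generators.
Variable K : fieldType.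
Implicit Types (f g h : freealg K) (m u v w : monomial).

Lemma derN a f : der a (- f) = - der a f.
Proof. by rewrite !der_mlin linearN. Qed.
Lemma derD a f g : der a (f + g) = der a f + der a g.
Proof. by rewrite !der_mlin linearD. Qed.
Lemma derZ a c f : der a (c *: f) = c *: der a f.
Proof. by rewrite !der_mlin linearZ. Qed.
Lemma der_mono a m : der a (mono m) = mder K a m.
Proof. by rewrite der_mlin mlin_mono. Qed.

Lemma ev11N f : ev11 (- f) = - ev11 f.
Proof. by rewrite !ev11_mlin linearN. Qed.
Lemma ev11D f g : ev11 (f + g) = ev11 f + ev11 g.
Proof. by rewrite !ev11_mlin linearD. Qed.
Lemma ev11Z c f : ev11 (c *: f) = c * ev11 f.
Proof. by rewrite !ev11_mlin linearZ. Qed.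
Lemma ev11_mono m : ev11 (mono m : freealg K) = 1.
Proof. by rewrite ev11_mlin mlin_mono. Qed.

Definition geo r : {poly K} := \sum_(i < r) 'X^i.

(* With powers of 'X expressed by geo, evanescence of a generator becomes a ring
   identity in 'X, geo p, geo q, ... *)
Lemma expX_geo r : 'X^r = 1 + ('X - 1) * geo r :> {poly K}.
Proof. by rewrite /geo -subrX1 addrC subrK. Qed.

Lemma geoD r s : geo (r + s) = geo r + (1 + ('X - 1) * geo r) * geo s.
Proof.
rewrite -expX_geo /geo big_split_ord /= mulr_sumr; congr (_ + _).
by apply: eq_bigr => i _; rewrite exprD.
Qed.

Lemma geo0 : geo 0 = 0. Proof. exact: big_ord0. Qed.
Lemma geoS r : geo r.+1 = 1 + 'X * geo r.
Proof.
rewrite /geo big_ord_recl expr0 mulr_sumr; congr (_ + _).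
by apply: eq_bigr => i _; rewrite exprS.
Qed.

(** The r new letters x have depths 1, ..., r, which gives t [geo r], and every leaf of [m] moves r
    levels down, which multiplies by t^r. *)
Lemma mder_xbr a r m :
  mder K a (xbr r m) =
  (a == lx)%:R * 'X * geo r + (1 + ('X - 1) * geo r) * mder K a m.
Proof.
elim: r => [|r IHr]; first by rewrite geo0 /=; ring.
by rewrite /= mder_mul mder_var eq_sym geoS IHr; ring.
Qed.

Lemma mder_xpow a p : mder K a (xpow p.+1) = mder K a (xbr p vx).
Proof. by []. Qed.

(** Meant for a goal whose right-hand side is an evar, which gets filled with the values at the
    monomials. *)
Ltac expand_lin := lazymatch goal with
  | |- der ?a (?f + ?g) = _ => refine (etrans (derD a f g) (congr2 +%R _ _)); expand_lin
  | |- der ?a (- ?f) = _ => refine (etrans (derN a f) (congr1 -%R _)); expand_lin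
  | |- der ?a (?c *: ?f) = _ => refine (etrans (derZ a c f) (congr1 ( *:%R c) _)); expand_lin
  | |- der ?a (mono ?m) = _ => exact: der_mono
  | |- ev11 (?f + ?g) = _ => refine (etrans (ev11D f g) (congr2 +%R _ _)); expand_lin
  | |- ev11 (- ?f) = _ => refine (etrans (ev11N f) (congr1 -%R _)); expand_lin
  | |- ev11 (?c *: ?f) = _ => refine (etrans (ev11Z c f) (congr1 ( *%R c) _)); expand_lin
  | |- ev11 (mono ?m) = _ => exact: ev11_mono
  end.

Lemma generator_vanishing f : generator f -> vanishing f.
Proof.
have exy : (lx == ly) = false by [].
have eyx : (ly == lx) = false by [].
case=> [p q|p q|p r|r p|p r|r s|p r|p q|p r|r s];
  (* Exponents become successors so that [mder_xpow] applies. *)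
  try (case: p => [//|p] _); try (case: q => [//|q] _); split.
all: rewrite /E_n /E_n1_pow_pow /E_n1_pow_br /E_n1_br_pow /E_n2_pow_br /E_n2_br_br
  /F_n2_pow_br /G_n2_pow_pow /G_n2_pow_br /G_n2_br_br.
all: apply: etrans; first by expand_lin.
all: rewrite ?addSn ?(mder_mul, mder_xpow, mder_xbr, mder_var) -?[_.+1.-1]/p.
all: rewrite ?(geoD, geoS, geo0) ?scaler_nat ?eqxx ?exy ?eyx /=.
all: ring.
Qed.
End Generators.

(** * Linear independence of FF modulo the ideal *)

Section Independence.
Variable K : fieldType.
Implicit Types (f g h : freealg K) (m u v w : monomial).

(** Filtration of [FF] by x-degree: it carries the induction for independence, and the reduction
    respects it, whence the bound on the x-degree of P_w. *)
Definition FF_le n m : Prop :=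
  exists2 r : nat, (r <= n)%N & m = (xbr r vy ** vy)%mg \/ m = xbr r (vy ** vy)%mg.

Lemma FF_le_FF n m : FF_le n m -> FF m.
Proof. by case=> r _ h; exists r. Qed.

Lemma occ_xbr a r m : occ a (xbr r m) = ((a == lx) * r + occ a m)%N.
Proof.
elim: r => [|r IHr]; first by rewrite muln0.
by rewrite /= occ_mul IHr mulnS addnA eq_sym.
Qed.

Lemma occ_FF_lx r m :
  m = (xbr r vy ** vy)%mg \/ m = xbr r (vy ** vy)%mg -> occ lx m = r.
Proof. by case=> ->; rewrite ?occ_mul occ_xbr ?occ_mul /= mul1n !addn0. Qed.

Lemma occ_FF_ly m : FF m -> occ ly m = 2%N.
Proof. by case=> r [] ->; rewrite ?occ_mul occ_xbr ?occ_mul. Qed.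

Lemma FF_le_occ m : FF m -> FF_le (occ lx m) m.
Proof. by case=> r h; exists r => //; rewrite (occ_FF_lx h). Qed.

Lemma coef_geo r k : (geo K r)`_k = (k < r)%:R.
Proof.
have -> : geo K r = \poly_(i < r) 1.
  by rewrite poly_def; apply: eq_bigr => i _; rewrite scale1r.
by rewrite coef_poly; case: ltnP.
Qed.

Lemma mder_lx_xbr_mul r : mder K lx (xbr r vy ** vy)%mg = 'X * ('X * geo K r).
Proof. by rewrite mder_mul mder_xbr !mder_var /=; ring. Qed.

Lemma mder_lx_xbr_yy r : mder K lx (xbr r (vy ** vy)%mg) = 'X * geo K r.
Proof. by rewrite mder_xbr mder_mul !mder_var /=; ring. Qed.

Lemma mder_ly_xbr_mul r : mder K ly (xbr r vy ** vy)%mg = 'X^(r.+1) + 'X :> {poly K}.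
Proof. by rewrite mder_mul mder_xbr !mder_var exprS [in RHS]expX_geo /=; ring. Qed.

Lemma mder_ly_xbr_yy r : mder K ly (xbr r (vy ** vy)%mg) = 'X^(r.+1) *+ 2 :> {poly K}.
Proof. by rewrite mder_xbr mder_mul !mder_var exprS [in RHS]expX_geo /=; ring. Qed.

Lemma coef_der a f k : (der a f)`_k = \sum_(m <- msupp f) f@_m * (mder K a m)`_k.
Proof. by rewrite /der coef_sum; apply: eq_bigr => m _; rewrite coefZ. Qed.

(** Reads off one coefficient of [f] when [m0] is the only monomial of the support that can
    contribute to t^k; [m0] may lie outside the support. *)
Lemma coef_der_single a f k m0 (c : K) :
  (forall m, m \in msupp f -> (mder K a m)`_k = (m == m0)%:R * c) ->
  (der a f)`_k = f@_m0 * c.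
Proof.
move=> H; rewrite coef_der (eq_big_seq (fun m => f@_m * ((m == m0)%:R * c))); last first.
  by move=> m mf; rewrite H.
case: msuppP => [m0f|m0f]; last first.
  rewrite mul0r big_seq big1 // => m mf; case: eqP => [e|_]; last by rewrite mul0r mulr0.
  by rewrite -e mf in m0f.
rewrite (bigD1_seq m0) ?fset_uniq //= eqxx mul1r big1 ?addr0 // => m /negbTE->.
by rewrite mul0r mulr0.
Qed.

(** Induction on a bound for the x-degrees. For the bound n+1, t^(n+2) occurs in [der lx] through A
    only; once A is gone, it occurs in [der ly] through B only, with coefficient 2. *)
Lemma mspan_FF_vanishing_eq0 f :
  2%N \notin [pchar K] -> mspan FF f -> vanishing f -> f = 0.
Proof.
move=> char2 fFF [dx dy e].
have two : (2%:R : K) != 0 by move: char2; rewrite inE /=.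
have [n] : exists n, mspan (FF_le n) f.
  exists (Defs.fdeg lx f) => m mf; case: (FF_le_occ (fFF _ mf)) => r le h.
  exists r => //; apply: leq_trans le _.
  exact: leq_bigmax_seq.
elim: n => [|n IHn] fn.
  (* In x-degree 0 both shapes are yy, and [ev11] is then its coefficient. *)
  have H m : m \in msupp f -> m = (vy ** vy)%mg.
    by move=> /fn[r]; rewrite leqn0 => /eqP-> [].
  apply/malgP => k; rewrite mcoeff0; case: msuppP => // kf.
  rewrite (H k kf) -{}e /ev11 (eq_big_seq (fun=> f@_(vy ** vy)%mg)); last first.
    by move=> m /H->.
  rewrite (_ : enum_fset (msupp f) = [:: (vy ** vy)%mg]) ?big_seq1 //.
  apply: perm_small_eq => //; apply: uniq_perm => // m; rewrite inE.
  by apply/idP/eqP => [/H //|->]; rewrite -(H k kf).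
pose A := (xbr n.+1 vy ** vy)%mg; pose B := xbr n.+1 (vy ** vy)%mg.
have occA : occ lx A = n.+1 by apply: occ_FF_lx; left.
have occB : occ lx B = n.+1 by apply: occ_FF_lx; right.
have fA : f@_A = 0.
  have := @coef_der_single lx f n.+2 A 1; rewrite dx coef0 mulr1 => <- // m /fn[r le mE].
  rewrite mulr1; have om := occ_FF_lx mE.
  case: mE => mE; rewrite mE.
    rewrite mder_lx_xbr_mul !coefXM /= coef_geo; congr (nat_of_bool _)%:R.
    apply/idP/eqP => [ltr|e1]; first by rewrite (_ : r = n.+1) //; lia.
    by move: om; rewrite mE e1 occA => <-.
  rewrite mder_lx_xbr_yy !coefXM /= coef_geo ltnNge le /=.
  (* A and B have the same x-degree; t^(n+2) in [mder K lx] tells them apart. *)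
  case: eqP => // eBA; have er : r = n.+1 by rewrite -om mE eBA occA.
  have := congr1 (fun m => (mder K lx m)`_n.+2) eBA; rewrite er.
  by rewrite mder_lx_xbr_mul mder_lx_xbr_yy !coefXM /= !coef_geo ltnn ltnSn => /eqP;
    rewrite eq_sym oner_eq0.
have fB : f@_B = 0.
  have := @coef_der_single ly f n.+2 B 2%:R; rewrite dy coef0 => H.
  apply/eqP; have := esym (H _) => /(_ _)/eqP; rewrite mulf_eq0 (negbTE two) orbF; apply.
  move=> m mf; have [r le mE] := fn _ mf.
  have mA : m <> A by move=> eA; move: mf; rewrite eA -mcoeff_neq0 fA eqxx.
  have om := occ_FF_lx mE; case: mE => mE.
    have ltr : (r != n.+1) by apply/eqP => er; apply: mA; rewrite mE er.
    rewrite (_ : (m == B) = false) ?mul0r; last first.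
      by apply/eqP => eB; move: ltr; rewrite -om eB occB eqxx.
    by rewrite mE mder_ly_xbr_mul coefD coefX coefXn eqSS eq_sym (negbTE ltr) addr0.
  rewrite mE mder_ly_xbr_yy coefMn coefXn eqSS.
  case: eqP => [<-|ne]; first by rewrite eqxx mul1r.
  case: eqP => [e1|]; last by rewrite mul0r mul0rn.
  by case: ne; rewrite -om mE e1 occB.
apply: IHn => m mf; have [r le mE] := fn _ mf; exists r => //.
move: le; rewrite leq_eqVlt => /orP[/eqP er|//].
by move: mf; rewrite -mcoeff_neq0; case: mE => ->; rewrite er ?fA ?fB eqxx.
Qed.
End Independence.

(** * Reduction of monomials *)

Section Ideal.
Variable K : fieldType.
Implicit Types (f g h : freealg K).

Lemma idealG_ideal : is_ideal (@idealG K).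
Proof.
split=> [I [I0 *]|f g If Ig I iI gI|c f If I iI gI|f g If I iI gI] //.
- by have [_ ID _ _] := iI; apply: ID; [exact: If | exact: Ig].
- by have [_ _ IZ _] := iI; apply: IZ; exact: If.
- by have [_ _ _ IM] := iI; apply: IM; exact: If.
Qed.

Lemma idealG0 : idealG (0 : freealg K).
Proof. by have [] := idealG_ideal. Qed.

Lemma idealGD f g : idealG f -> idealG g -> idealG (f + g).
Proof. by have [_ D _ _] := idealG_ideal; exact: D. Qed.

Lemma idealGZ c f : idealG f -> idealG (c *: f).
Proof. by have [_ _ Z _] := idealG_ideal; exact: Z. Qed.

Lemma idealGN f : idealG f -> idealG (- f).
Proof. by rewrite -scaleN1r; exact: idealGZ. Qed.

Lemma idealG_fmul f g : idealG f -> idealG (fmul f g).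
Proof. by have [_ _ _ M] := idealG_ideal; exact: M. Qed.

Lemma idealG_trans g f h : idealG (f - g) -> idealG (g - h) -> idealG (f - h).
Proof. by move=> If Ig; rewrite -(subrKA g); exact: idealGD. Qed.

Lemma idealG_generator f : generator f -> idealG f.
Proof. by move=> gf I _; exact. Qed.

Lemma idealG_vanishing f : idealG f -> vanishing f.
Proof. by move=> If; apply: If; [exact: vanishing_ideal | exact: generator_vanishing]. Qed.

(** The list does not mention the field, so the same combination can be read over every [K]. *)
Definition lin (s : seq (int * monomial)) : freealg K :=
  \sum_(p <- s) p.1%:~R *: mono p.2.

Lemma lin_cons p s : lin (p :: s) = p.1%:~R *: mono p.2 + lin s.
Proof. exact: big_cons. Qed.

Lemma lin_nil : lin [::] = 0.
Proof. exact: big_nil. Qed.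

Lemma lin_cat s t : lin (s ++ t) = lin s + lin t.
Proof. exact: big_cat. Qed.

Lemma lin_scale c s : lin [seq (c * p.1, p.2) | p <- s] = c%:~R *: lin s.
Proof.
rewrite /lin big_map scaler_sumr; apply: eq_bigr => p _ /=.
by rewrite scalerA intrM.
Qed.

Lemma fmul_lin s v :
  fmul (lin s) (mono v) = lin [seq (p.1, (p.2 ** v)%mg) | p <- s].
Proof.
rewrite fmul_mlin linear_sum [RHS]big_map; apply: eq_bigr => p _.
by rewrite linearZ /= !mlin_mono.
Qed.

Lemma fmul_subl f g h : fmul (f - g) h = fmul f h - fmul g h.
Proof. by rewrite !fmul_mlin linearB. Qed.
End Ideal.

(** Recursive, so that on an explicit list it unfolds to a conjunction. *)
Fixpoint all_in (S : monomial -> Prop) (s : seq (int * monomial)) : Prop :=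
  if s is p :: s' then S p.2 /\ all_in S s' else True.

(** The list is chosen before the field: this is what makes the reduction over K the image of
    P_w. *)
Definition reducible (S : monomial -> Prop) (w : monomial) : Prop :=
  exists s : seq (int * monomial),
    all_in S s /\ forall K : fieldType, idealG (mono w - lin K s).

Section Reduction.
Implicit Types (S T : monomial -> Prop) (u v w m : monomial).

Lemma all_in_cat S s t : all_in S s -> all_in S t -> all_in S (s ++ t).
Proof. by elim: s => //= p s IHs [Sp Ss] St; split=> //; exact: IHs. Qed.

Lemma all_in_map S T (F : int * monomial -> int * monomial) s :
  (forall p, S p.2 -> T (F p).2) -> all_in S s -> all_in T (map F s).
Proof. by move=> ST; elim: s => //= p s IHs [/ST ? /IHs]. Qed.

Lemma reducible_self S w : S w -> reducible S w.
Proof.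
move=> Sw; exists [:: (1, w)]; split=> // K.
by rewrite lin_cons lin_nil addr0 scale1r subrr; exact: idealG0.
Qed.

Lemma reducible_lin S s :
  all_in (reducible S) s ->
  exists t, all_in S t /\ forall K : fieldType, idealG (lin K s - lin K t).
Proof.
elim: s => [_|p s IHs [[t1 [St1 red1]] /IHs[t2 [St2 red2]]]].
  by exists [::]; split=> // K; rewrite subrr; exact: idealG0.
exists ([seq (p.1 * q.1, q.2) | q <- t1] ++ t2); split.
  by apply: all_in_cat => //; apply: all_in_map St1.
move=> K; rewrite lin_cons lin_cat lin_scale opprD addrACA.
by rewrite -scalerBr; apply: idealGD => //; exact: idealGZ.
Qed.

(** Multiplying a reduction of [u] by [v] stays in the ideal, and the resulting products are reduced
    one by one. *)
Lemma reducible_mull S T u v :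
  reducible S u -> (forall m, S m -> reducible T (m ** v)%mg) ->
  reducible T (u ** v)%mg.
Proof.
move=> [s [Ss red]] ST.
have [|t [Tt redt]] := @reducible_lin T [seq (p.1, (p.2 ** v)%mg) | p <- s].
  by apply: all_in_map Ss => p; exact: ST.
exists t; split=> // K; apply: idealG_trans (redt K).
by rewrite -fmulUU -fmul_lin -fmul_subl; exact: idealG_fmul.
Qed.

Lemma reducible_mul S1 S2 T u v :
  reducible S1 u -> reducible S2 v ->
  (forall m1 m2, S1 m1 -> S2 m2 -> reducible T (m1 ** m2)%mg) ->
  reducible T (u ** v)%mg.
Proof.
move=> redu redv red; apply: reducible_mull redu _ => m1 Sm1.
by rewrite mmulC; apply: reducible_mull redv _ => m2 Sm2; rewrite mmulC; exact: red.
Qed.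

Lemma reducible_gen S w s :
  all_in S s -> (forall K : fieldType, generator (mono w - lin K s)) ->
  reducible S w.
Proof. by move=> Ss gen; exists s; split=> // K; apply: idealG_generator. Qed.

End Reduction.


(** * Reduction of monomials of y-degree 0, 1 and 2 *)

Section MonomialReduction.
Local Notation x := vx.
Local Notation y := vy.
Local Notation y2 := (vy ** vy)%mg.
Implicit Types (u v w m : monomial).
Local Open Scope magma_scope.

Definition pow_le n m : Prop := exists2 p, (0 < p <= n)%N & m = xpow p.
(** Normal forms of y-degree 1. The exponent p = 1 is left out of the first kind because x^1 y is
    x^{1}y. *)
Definition lin_y_le n m : Prop :=
  (exists2 p, (1 < p <= n)%N & m = xpow p ** y) \/
  (exists2 r, (r <= n)%N & m = xbr r y).

Lemma pow_le_xpow n p : (0 < p <= n)%N -> pow_le n (xpow p).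
Proof. by exists p. Qed.
Lemma lin_y_le_pow n p : (0 < p <= n)%N -> lin_y_le n (xpow p ** y).
Proof.
case: p => [//|[|p]] le; last by left; exists p.+2.
by right; exists 1%N.
Qed.
Lemma lin_y_le_br n r : (r <= n)%N -> lin_y_le n (xbr r y).
Proof. by right; exists r. Qed.
Lemma FF_le_xbr_mul n r : (r <= n)%N -> FF_le n (xbr r y ** y).
Proof. by exists r => //; left. Qed.
Lemma FF_le_xbr_yy n r : (r <= n)%N -> FF_le n (xbr r y2).
Proof. by exists r => //; right. Qed.

(** The explicit exponents make x(xy), xy, (xy)y, xy^2 and y^2 match the iterated products by
    conversion. *)
Ltac members := repeat split;
  [first [apply: pow_le_xpow | apply: lin_y_le_pow | apply: (@lin_y_le_br _ 2)
  | apply: (@lin_y_le_br _ 1) | apply: lin_y_le_br | apply: (@FF_le_xbr_mul _ 1)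
  | apply: (@FF_le_xbr_yy _ 1) | apply: (@FF_le_xbr_yy _ 0)
  | apply: FF_le_xbr_mul | apply: FF_le_xbr_yy]; lia ..].

(** Once the sum is unlocked and the monomials are abstracted, the two sides differ only by signs
    and bracketing. *)
Ltac same_gen G := move=> K; have := G K; congr generator;
  rewrite ?/E_n ?/E_n1_pow_pow ?/E_n1_pow_br ?/E_n1_br_pow ?/E_n2_pow_br ?/E_n2_br_br
    ?/F_n2_pow_br ?/G_n2_pow_pow ?/G_n2_pow_br ?/G_n2_br_br /lin unlock /=;
  repeat match goal with |- context [mono ?m] => move: (mono m) => ? end;
  rewrite ?intrN ?scaleNr ?opprD ?opprK ?oppr0 ?addr0 ?scale1r ?addrA //.

(** A factor x raises the exponent by one; otherwise [E_n] applies. Both p+1 and q+1 stay below a+b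
    because the exponents are positive. *)
Lemma reducible_00 a b u v : pow_le a u -> pow_le b v -> reducible (pow_le (a + b)) (u ** v).
Proof.
case=> p pa -> [q qb ->].
have [p1|p1] := leqP p 1.
  have -> : p = 1%N by lia.
  by apply: reducible_self; rewrite -xpowS; [apply: pow_le_xpow|]; lia.
have [q1|q1] := leqP q 1.
  have -> : q = 1%N by lia.
  by apply: reducible_self; rewrite mmulC -xpowS; [apply: pow_le_xpow|]; lia.
apply: (@reducible_gen _ _ [:: (1, xpow p.+1); (1, xpow q.+1); (-1, xpow 2)]).
  by members.
same_gen (fun K => @Gen_E_n K p q p1 q1).
Qed.

Lemma reducible_01 a b u v : pow_le a u -> lin_y_le b v -> reducible (lin_y_le (a + b)) (u ** v).
Proof.
case=> p pa -> [[q qb ->]|[r rb ->]].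
  have [p1|p1] := leqP p 1.
    have -> : p = 1%N by lia.
    (* x(x^q y) is x^{1}(x^q y), so the generator [E_n1_br_pow] with r = 1 applies. *)
    rewrite -[xpow 1 ** _]/(xbr 1 _).
    apply: (@reducible_gen _ _
      [:: (1, xbr 2 y); (1, xpow (q + 1) ** y); (-1, xpow 2 ** y)]).
      by members.
    have q1 : (1 < q)%N by lia.
    same_gen (fun K => @Gen_E_n1_br_pow K 1 q q1).
  have q1 : (1 < q)%N by lia.
  apply: (@reducible_gen _ _ [:: (1, x ** (x ** y)); (1, xpow p ** y);
    (1, xpow q.+1 ** y); (-1, xpow 2 ** y); (-1, x ** y)]).
    by members.
  same_gen (fun K => @Gen_E_n1_pow_pow K p q p1 q1).
have [p1|p1] := leqP p 1.
  have -> : p = 1%N by lia.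
  by apply: reducible_self; apply: (@lin_y_le_br _ r.+1); lia.
apply: (@reducible_gen _ _ [:: (1, xpow p ** y); (1, xbr r.+1 y); (-1, x ** y)]).
  by members.
same_gen (fun K => @Gen_E_n1_pow_br K p r p1).
Qed.

Lemma reducible_02 a b u v :
  pow_le a u -> FF_le b v -> reducible (FF_le (a + b)) (u ** v).
Proof.
case=> p pa -> [r rb []] ->; have [p1|p1] := leqP p 1.
- have -> : p = 1%N by lia.
  (* x((x^{r}y)y) is not in [FF]; it is the leading monomial of [E_n2_br_br 1 r]. *)
  rewrite -[xpow 1 ** _]/(xbr 1 _).
  apply: (@reducible_gen _ _
    [:: (1, xbr (1 + r) y ** y); (-1, xbr 1 y ** y); (1, xbr 1 y2)]).
    by members.
  same_gen (fun K => @Gen_E_n2_br_br K 1 r).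
- apply: (@reducible_gen _ _ [:: (2, xbr p.-1 y ** y); (1, xbr r.+1 y ** y);
    (-1, xbr p.-1 y2); (-1, (x ** y) ** y); (1, x ** y2); (-1, y2)]).
    by members.
  same_gen (fun K => @Gen_E_n2_pow_br K p r p1).
- have -> : p = 1%N by lia.
  by apply: reducible_self; apply: (@FF_le_xbr_yy _ r.+1); lia.
- apply: (@reducible_gen _ _ [:: (2, xbr p.-1 y ** y); (-1, xbr p.-1 y2);
    (1, xbr r.+1 y2); (-1, y2)]).
    by members.
  same_gen (fun K => @Gen_F_n2_pow_br K p r p1).
Qed.

Lemma reducible_11 a b u v :
  lin_y_le a u -> lin_y_le b v -> reducible (FF_le (a + b)) (u ** v).
Proof.
(* The mixed product is needed for both orders of the factors. *)
have pow_br p r : (1 < p <= a + b)%N -> (r <= a + b)%N ->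
    reducible (FF_le (a + b)) ((xpow p ** y) ** xbr r y).
  move=> pa rb; have p1 : (1 < p)%N by lia.
  apply: (@reducible_gen _ _ [:: (2, xbr p y ** y); (1, xbr r y ** y);
    (-1, xbr p y2); (-1, (x ** y) ** y); (1, x ** y2); (-1, y2)]).
    by members.
  same_gen (fun K => @Gen_G_n2_pow_br K p r p1).
case=> [[p pa]|[r ra]] -> [[q qb]|[s sb]] ->.
- have p1 : (1 < p)%N by lia.
  have q1 : (1 < q)%N by lia.
  apply: (@reducible_gen _ _ [:: (2, xbr p y ** y); (2, xbr q y ** y);
    (-1, xbr p y2); (-1, xbr q y2); (-2, (x ** y) ** y); (2, x ** y2); (-1, y2)]).
    by members.
  same_gen (fun K => @Gen_G_n2_pow_pow K p q p1 q1).
- by apply: pow_br; lia.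
- by rewrite mmulC; apply: pow_br; lia.
- apply: (@reducible_gen _ _
    [:: (1, xbr r y ** y); (1, xbr s y ** y); (-1, y2)]).
    by members.
  same_gen (fun K => @Gen_G_n2_br_br K r s).
Qed.

(** Structural induction, here and in the next two lemmas: the factors are reduced first, and the
    x-degree bounds add up in the product. *)
Lemma reducible_type0 m : occ ly m = 0%N -> reducible (pow_le (occ lx m)) m.
Proof.
elim/monomial_ind: m => [[]|u v IHu IHv] //.
  by move=> _; apply: reducible_self; exists 1%N.
rewrite !occ_mul => /eqP; rewrite addn_eq0 => /andP[/eqP u0 /eqP v0].
by apply: reducible_mul (IHu u0) (IHv v0) _ => m1 m2; exact: reducible_00.
Qed.

Lemma reducible_type1 m : occ ly m = 1%N -> reducible (lin_y_le (occ lx m)) m.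
Proof.
elim/monomial_ind: m => [[]|u v IHu IHv] //.
  by move=> _; apply: reducible_self; right; exists 0%N.
rewrite !occ_mul => e.
have [[u0 v1]|[u1 v0]] : (occ ly u = 0 /\ occ ly v = 1 \/ occ ly u = 1 /\ occ ly v = 0)%N.
  by lia.
  by apply: reducible_mul (reducible_type0 u0) (IHv v1) _ => m1 m2; exact: reducible_01.
rewrite mmulC addnC.
by apply: reducible_mul (reducible_type0 v0) (IHu u1) _ => m1 m2; exact: reducible_01.
Qed.

Lemma reducible_type2 m : occ ly m = 2%N -> reducible (FF_le (occ lx m)) m.
Proof.
elim/monomial_ind: m => [[]|u v IHu IHv] //.
rewrite !occ_mul => e.
have [[u0 v2]|[[u2 v0]|[u1 v1]]] :
    (occ ly u = 0 /\ occ ly v = 2 \/ (occ ly u = 2 /\ occ ly v = 0 \/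
     occ ly u = 1 /\ occ ly v = 1))%N.
- by lia.
- by apply: reducible_mul (reducible_type0 u0) (IHv v2) _ => m1 m2; exact: reducible_02.
- rewrite mmulC addnC.
  by apply: reducible_mul (reducible_type0 v0) (IHu u2) _ => m1 m2; exact: reducible_02.
apply: reducible_mul (reducible_type1 u1) (reducible_type1 v1) _ => m1 m2.
exact: reducible_11.
Qed.
End MonomialReduction.

(** * Non-homogeneity *)

Section LeafDepth.
Variable K : fieldType.
Local Notation x := vx.
Local Notation y := vy.
Implicit Types (u v w m : monomial).
Local Open Scope magma_scope.

Lemma occ_gt0 m : (0 < occ lx m + occ ly m)%N.
Proof. by elim/monomial_ind: m => [[]|u v IHu IHv] //; rewrite !occ_mul; lia. Qed.

Lemma occ_eq1_vx m : occ lx m = 1%N -> occ ly m = 0%N -> m = x.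
Proof.
elim/monomial_ind: m => [[]|u v _ _] //; rewrite !occ_mul.
by have := occ_gt0 u; have := occ_gt0 v; lia.
Qed.

Lemma mder_occ0 a m : occ a m = 0%N -> mder K a m = 0.
Proof.
elim/monomial_ind: m => [b|u v IHu IHv].
  by rewrite mder_var /occ /=; case: (b == a).
rewrite occ_mul => /eqP; rewrite addn_eq0 => /andP[/eqP u0 /eqP v0].
by rewrite mder_mul IHu // IHv // addr0 mulr0.
Qed.

(* k is the depth of the leaf y. *)
Lemma mder_ly_type1 m : occ ly m = 1%N -> exists k,
  [/\ mder K ly m = 'X^k, (k <= occ lx m)%N,
      k = occ lx m -> m = xbr k y & k = 0%N -> occ lx m = 0%N].
Proof.
elim/monomial_ind: m => [[]|u v IHu IHv] //.
  by move=> _; exists 0%N; split=> //; rewrite mder_var expr0.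
rewrite !occ_mul.
(* By commutativity the leaf y may be taken in [v]. *)
wlog u0 : u v IHu IHv / occ ly u = 0%N => [H e|].
  have [u0|v0] : (occ ly u = 0 \/ occ ly v = 0)%N by lia.
    exact: H.
  by rewrite mmulC addnC; apply: H => //; rewrite addnC.
rewrite u0 => /IHv[k [mk le top _]]; exists k.+1.
(* [u] contains an x, so the x-degree grows at least as much as the depth, and equally only for u =
   x. *)
have a0 := occ_gt0 u; rewrite u0 addn0 in a0.
rewrite mder_mul mder_occ0 // add0r mk exprS; split=> //; first by lia.
move=> e; have ux : u = x by apply: occ_eq1_vx; lia.
by rewrite ux /= -top //; lia.
Qed.

(* i and j are the depths of the two leaves y. *)
Lemma mder_ly_type2 m : occ ly m = 2%N -> exists i j,
  [/\ mder K ly m = 'X^i + 'X^j, (0 < i <= j)%N /\ (j <= (occ lx m).+1)%N,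
      (1 < occ lx m -> 1 < j)%N,
      i = 1%N -> j = (occ lx m).+1 -> m = xbr (occ lx m) y ** y
    & i = (occ lx m).+1 -> m = xbr (occ lx m) (y ** y)].
Proof.
elim/monomial_ind: m => [[]|u v IHu IHv] //; rewrite !occ_mul.
move=> e; have [[u1 v1]|uv] :
    (occ ly u = 1 /\ occ ly v = 1 \/ occ ly u = 0 \/ occ ly v = 0)%N by lia.
  have [i [ui ia topu zu]] := mder_ly_type1 u1.
  have [j [vj jb topv zv]] := mder_ly_type1 v1.
  wlog ij : u v u1 v1 i j ui vj ia jb topu topv zu zv {IHu IHv e} / (i <= j)%N => [H|].
    have [ij|/ltnW ji] := leqP i j; first exact: (H u v u1 v1 i j).
    by rewrite mmulC addnC; apply: (H v u v1 u1 j i).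
  exists i.+1, j.+1; split; first by rewrite mder_mul ui vj mulrDr -!exprS.
  - by lia.
  - by lia.
  (* A leaf y at depth 0 in [u] forces u = y, and the maximal depth of the other one determines
     [v]. *)
  - move=> [i0] [je].
    have eu : u = y by rewrite topu i0 // zu.
    have : v = xbr (occ lx u + occ lx v) y by rewrite -je; apply: topv; lia.
    by move: (addn _ _) => n ->; rewrite eu mmulC.
  (* From i <= j and the two depth bounds, i can equal the total x-degree only if that degree is
     0. *)
  - move=> [ie]; have j0 : j = 0%N by lia.
    have i0 : i = 0%N by lia.
    have eu : u = y by rewrite topu i0 // zu.
    have ev : v = y by rewrite topv j0 // zv.
    by rewrite eu ev.
wlog u0 : u v IHu IHv e {uv} / occ ly u = 0%N => [H|].
  case: uv => [u0|v0]; first exact: H.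
  by rewrite mmulC addnC; apply: H => //; rewrite addnC.
have [i [j [mv [ij jb] big top1 top2]]] := IHv (etrans (esym (congr1 (addn^~ _) u0)) e).
have a0 := occ_gt0 u; rewrite u0 addn0 in a0.
exists i.+1, j.+1; split.
- by rewrite mder_mul mder_occ0 // add0r mv mulrDr -!exprS.
- by lia.
- by lia.
(* Both leaves y lie inside [v], so neither has depth 1. *)
- by lia.
move=> [ie]; have ux : u = x by apply: occ_eq1_vx; lia.
by rewrite ux (_ : occ lx x = 1%N) // add1n /= -top2 //; lia.
Qed.
End LeafDepth.

(** * Train identities and reduced forms *)

Section TrainIdentities.
Variable K : fieldType.
Implicit Types (f g h P : freealg K) (m w : monomial) (s : seq (int * monomial)).

Lemma mspanB S f g : mspan S f -> mspan S g -> mspan S (f - g).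
Proof.
move=> Sf Sg m /(fsubsetP (msuppB_le _ _)); rewrite in_fsetU.
by case/orP => [/Sf|/Sg].
Qed.

Lemma mspan_mono (S : monomial -> Prop) m : S m -> mspan S (mono m : freealg K).
Proof. by move=> Sm k; rewrite msuppU oner_eq0 in_fset1 => /eqP->. Qed.

Lemma mspanW (S T : monomial -> Prop) f :
  (forall m, S m -> T m) -> mspan S f -> mspan T f.
Proof. by move=> ST Sf m /Sf /ST. Qed.

Lemma mspan_lin S s : all_in S s -> mspan S (lin K s).
Proof.
elim: s => [_|p s IHs [Sp Ss]] m; first by rewrite lin_nil msupp0.
rewrite lin_cons => /(fsubsetP (msuppD_le _ _)); rewrite in_fsetU.
case/orP => [/(fsubsetP (msuppZ_le _ _)) | ]; last exact: IHs.
by rewrite msuppU oner_eq0 in_fset1 => /eqP->.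
Qed.

(** If all monomials of [f] have y-degree 2, this is the component of type [i,2]. *)
Definition xpart (i : nat) f : freealg K :=
  mlin (fun m => if occ lx m == i then mono m else 0) f.

Lemma coef_mlin (phi : monomial -> freealg K) f k :
  (mlin phi f)@_k = \sum_(m <- msupp f) f@_m * (phi m)@_k.
Proof. by rewrite raddf_sum; apply: eq_bigr => m _; exact: mcoeffZ. Qed.

Lemma coef_xpart i f k : (xpart i f)@_k = if occ lx k == i then f@_k else 0.
Proof.
(* Expanding [f] by [monoE] turns both sides into sums over the same support. *)
have -> : (if occ lx k == i then f@_k else 0) =
    (mlin mono f)@_k * (occ lx k == i)%:R.
  by rewrite -monoE; case: eqP; rewrite ?mulr1 ?mulr0.
rewrite !coef_mlin mulr_suml; apply: eq_bigr => m _; rewrite -mulrA; congr (_ * _).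
rewrite [(mono m)@_k]mcoeffU; case: (eqVneq m k) => [->|ne].
  by case: eqP; rewrite ?mcoeff0 ?mulr0 // mcoeffUU mulr1.
rewrite mul0r; case: ifP => _; last exact: mcoeff0.
by rewrite mcoeffU (negbTE ne).
Qed.

Lemma xpart_sum n f : mspan (fun m => (occ lx m < n)%N) f ->
  f = \sum_(i < n) xpart i f.
Proof.
move=> fn; apply/malgP => k; rewrite raddf_sum /=.
rewrite (eq_bigr (fun i : 'I_n => if (i : nat) == occ lx k then f@_k else 0)); last first.
  by move=> i _; rewrite coef_xpart eq_sym.
case: msuppP => [/fn kn|_]; last by rewrite big1 // => i _; case: ifP.
rewrite (bigD1 (Ordinal kn)) //= eqxx big1 ?addr0 // => i.
by rewrite -val_eqE /= => /negbTE->.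
Qed.

Lemma mspan_xpart b i f : mspan (fun m => occ ly m = b) f ->
  mspan (of_type i b) (xpart i f).
Proof.
move=> fb m; rewrite -mcoeff_neq0 coef_xpart.
case: (eqVneq (occ lx m) i) => [<-|_]; last by rewrite eqxx.
by rewrite mcoeff_neq0 => /fb.
Qed.

Lemma homogeneous0 : homogeneous (0 : freealg K).
Proof. by exists 0%N, 0%N => m; rewrite msupp0. Qed.

(** Splitting by x-degree, g is the top component and the h_i are the negatives of all lower ones,
    with d i = i; some h_i may be 0. *)
Lemma evanescent_train_vanishing f :
  mspan (fun m => occ ly m = 2%N) f -> ~ homogeneous f -> vanishing f ->
  evanescent_train f.
Proof.
move=> f2 nhom [dx dy e].
have f0 : f <> 0 by move=> f0; apply: nhom; rewrite f0; exact: homogeneous0.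
split; last by split.
have [m mf maxm] : exists2 m, m \in msupp f &
    forall k, k \in msupp f -> (occ lx k <= occ lx m)%N.
  have [m mf] : exists m, m \in msupp f.
    apply/fset0Pn/eqP => e0; apply: f0; apply/malgP => k.
    by rewrite mcoeff0 mcoeff_outdom // e0 in_fset0.
  have [k _ /= maxk] := arg_maxnP (P := predT) (fun k : msupp f => occ lx (val k))
    (isT : predT [` mf]%fset).
  exists (val k); first exact: valP.
  by move=> l lf; exact: (maxk [` lf]%fset).
pose n := occ lx m; exists n; split=> //.
exists (xpart n f), n, (fun i => i), (fun i => - xpart i f); split=> //.
- split; last exact: mspan_xpart.
  move=> /(congr1 (mcoeff m)); rewrite coef_xpart eqxx mcoeff0.
  by apply/eqP; rewrite mcoeff_neq0.
- by move=> i k; rewrite msuppN => kf; apply: mspan_xpart kf.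
have fE : f = \sum_(i < n.+1) xpart i f by apply: xpart_sum => k /maxm.
by rewrite [LHS]fE big_ord_recr /= [LHS]addrC; congr (_ + _); rewrite sumrN opprK.
Qed.

Lemma not_homogeneous_sub n w P :
  2%N \notin [pchar K] -> (2 <= n)%N -> of_type n 2 w -> ~ FF w ->
  mspan FF P -> vanishing (mono w - P) -> ~ homogeneous (mono w - P).
Proof.
move=> char2 n2 [wn w2] wFF PFF [_ dy e] [a [b hom]].
have two : (2%:R : K) != 0 by move: char2; rewrite inE /=.
have wP : w \notin msupp P by apply/negP => /PFF.
(* [w] does not cancel against [P], so the common type must be [n,2]. *)
have [] : of_type a b w.
  apply: hom; rewrite -mcoeff_neq0 mcoeffB mcoeffUU (mcoeff_outdom wP) subr0.
  exact: oner_neq0.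
rewrite wn w2 => aE bE; subst a b.
pose A := (xbr n vy ** vy)%mg; pose B := xbr n (vy ** vy)%mg.
have PAB k : k \in msupp P -> k = A \/ k = B.
  move=> kP; have [kn _] : of_type n 2 k.
    apply: hom; rewrite -mcoeff_neq0 mcoeffB mcoeffU.
    case: (eqVneq w k) => [ewk|_]; first by rewrite ewk kP in wP.
    by rewrite sub0r oppr_eq0 mcoeff_neq0.
  by case: (PFF k kP) => r h; move: (h); rewrite -(occ_FF_lx h) kn.
(* In [mder K ly] the coefficient of t is 1 for A and 0 for B. *)
have nAB : A != B.
  apply/eqP => /(congr1 (fun m => (mder K ly m)`_1)).
  rewrite mder_ly_xbr_mul mder_ly_xbr_yy coefD coefMn coefX coefXn /=.
  by case: n n2 {wn hom A B PAB} => // n' _ /eqP; rewrite mul0rn add0r oner_eq0.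
have PE : P = P@_A *: mono A + P@_B *: mono B.
  apply/malgP => k; rewrite mcoeffD !mcoeffZ !mcoeffU.
  case: (eqVneq A k) => [<-|nA].
    by rewrite eq_sym (negbTE nAB) mulr1 mulr0 addr0.
  case: (eqVneq B k) => [<-|nB]; first by rewrite mulr0 mulr1 add0r.
  rewrite !mulr0 addr0 mcoeff_outdom //; apply/negP => /PAB[] ek.
    by rewrite ek eqxx in nA.
  by rewrite ek eqxx in nB.
move: (P@_A) (P@_B) PE => al be PE.
have eB : be = 1 - al.
  move: e; rewrite PE ev11D ev11N ev11D !ev11Z !ev11_mono !mulr1 => /eqP.
  by rewrite subr_eq0 => /eqP->; rewrite addrC addKr.
have [i [j [wij [/andP[i0 ij] jn] big topA topB]]] := mder_ly_type2 K w2.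
rewrite wn in jn big topA topB.
have dw : 'X^i + 'X^j = al *: ('X^(n.+1) + 'X) + be *: ('X^(n.+1) *+ 2).
  move: dy; rewrite derD derN der_mono wij PE derD !derZ !der_mono mder_ly_xbr_mul mder_ly_xbr_yy.
  by move/eqP; rewrite subr_eq0 => /eqP.
(* Coefficient of t in [dw]; j and n+1 both exceed 1. *)
have c1 : (i == 1%N)%:R = al.
  have := congr1 (fun p : {poly K} => p`_1) dw.
  rewrite !(coefD, coefZ, coefMn, coefX, coefXn) /=.
  rewrite (_ : (1 == j)%N = false); last by lia.
  rewrite (_ : (1 == n.+1)%N = false); last by lia.
  by rewrite eq_sym addr0 /= => ->; ring.
(* Coefficient of t^(n+1) in [dw], where al + 2 be = 2 - al. *)
have cn : (i == n.+1)%:R + (j == n.+1)%:R = 2%:R - (i == 1%N)%:R :> K.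
  have := congr1 (fun p : {poly K} => p`_n.+1) dw.
  rewrite !(coefD, coefZ, coefMn, coefX, coefXn) eqxx.
  rewrite (_ : (n.+1 == 1)%N = false); last by lia.
  by rewrite eB -c1 ![n.+1 == _]eq_sym /= => ->; ring.
case: (eqVneq i 1%N) cn => [i1|_].
  rewrite i1 (_ : (1%N == n.+1) = false) ?add0r; last by lia.
  case: (eqVneq j n.+1) => [jE _|_].
    by apply: wFF; exists n; left; exact: topA.
  by rewrite (_ : 2%:R - 1 = 1 :> K); [move/eqP; rewrite eq_sym oner_eq0|ring].
case: (eqVneq i n.+1) => [iE _|_].
  by apply: wFF; exists n; right; exact: topB.
(* With i neither 1 nor n+1, [cn] would read 1 = 2 or 0 = 2; the latter is excluded by the
   characteristic. *)
rewrite add0r subr0; case: (j == n.+1) => /eqP.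
  by rewrite eq_sym -subr_eq0 (_ : 2%:R - 1 = 1 :> K) ?oner_eq0 //; ring.
by rewrite eq_sym (negbTE two).
Qed.

Lemma reduced_form_idealG f P : mspan FF P -> idealG (f - P) -> reduced_form f P.
Proof.
move=> PFF If; split=> //; apply: functional_extensionality => g.
apply: propositional_extensionality; split=> Ig.
  exact: idealG_trans Ig If.
by apply: idealG_trans Ig _; rewrite -opprB; exact: idealGN.
Qed.

Lemma reduced_form_vanishing f P : reduced_form f P -> mspan FF P /\ vanishing (f - P).
Proof.
case=> PFF pi_eq; split=> //; apply: idealG_vanishing.
by rewrite -/(piG P f) -pi_eq /piG subrr; exact: idealG0.
Qed.

(** P - Q is a difference of two vanishing polynomials in the span of [FF]. Used over K for reduced
    forms and over the rationals for P_w. *)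
Lemma vanishing_sub_unique f P Q :
  2%N \notin [pchar K] -> mspan FF P -> mspan FF Q ->
  vanishing (f - P) -> vanishing (f - Q) -> P = Q.
Proof.
move=> char2 PFF QFF vP vQ; apply/eqP; rewrite -subr_eq0; apply/eqP.
apply: mspan_FF_vanishing_eq0 => //; first exact: mspanB.
rewrite -(subrKA f) addrC; apply: vanishingD => //.
by rewrite -opprB -scaleN1r; exact: vanishingZ.
Qed.

Lemma unique_reduced_form f P :
  2%N \notin [pchar K] -> mspan FF P -> idealG (f - P) -> unique (reduced_form f) P.
Proof.
move=> char2 PFF If; split; first exact: reduced_form_idealG.
move=> Q /reduced_form_vanishing[QFF vQ].
exact: vanishing_sub_unique (idealG_vanishing If) vQ.
Qed.

Lemma reduction_exists f :
  mspan (fun m => occ ly m = 2%N) f -> exists2 R, mspan FF R & idealG (f - R).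
Proof.
have mspanD g h : mspan FF g -> mspan FF h -> mspan FF (g + h).
  move=> gFF hFF m /(fsubsetP (msuppD_le _ _)); rewrite in_fsetU.
  by case/orP => [/gFF|/hFF].
suff red_sum (r : seq monomial) : (forall m, m \in r -> occ ly m = 2%N) ->
    exists2 R, mspan FF R & idealG (\sum_(m <- r) f@_m *: mono m - R).
  by move=> /red_sum[R RFF]; rewrite -[X in idealG (X - _)]/(mlin mono f) -monoE; exists R.
elim: r => [|m r IHr] H.
  by exists 0; [move=> k; rewrite msupp0 | rewrite big_nil subr0; exact: idealG0].
have [|R RFF IR] := IHr; first by move=> k kr; apply: H; rewrite inE kr orbT.
have [s [sFF red]] := reducible_type2 (H m (mem_head _ _)).
exists (f@_m *: lin K s + R).
  apply: mspanD => // k /(fsubsetP (msuppZ_le _ _)) kl.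
  exact/FF_le_FF/(mspan_lin sFF).
rewrite big_cons opprD addrACA -scalerBr; apply: idealGD => //.
exact: idealGZ.
Qed.

End TrainIdentities.

Lemma coef_lin (K : fieldType) s k :
  (lin K s)@_k = (\sum_(p <- s) p.1 * (p.2 == k)%:Z)%:~R.
Proof.
rewrite raddf_sum rmorph_sum; apply: eq_bigr => p _.
by rewrite [LHS]mcoeffZ mcoeffU /= intrM; case: eqP.
Qed.

Lemma coef_base_change (K : fieldType) (P : freealg rat) k :
  (base_change K P)@_k = ratr P@_k.
Proof.
rewrite raddf_sum (eq_bigr (fun m => (ratr P@_m : K) *+ (m == k))); last first.
  by move=> m _; exact: mcoeffU.
case: msuppP => kP.
  rewrite (bigD1_seq k) ?fset_uniq //= eqxx big1 ?addr0 // => m /negbTE->.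
  exact: mulr0n.
rewrite (ratr_int _ 0) big_seq big1 // => m mP.
by case: eqP => // mk; rewrite -mk mP in kP.
Qed.

Lemma coefs_in_lin (K : fieldType) s : coefs_in K (lin rat s).
Proof. by move=> m; rewrite coef_lin denq_int oner_neq0. Qed.

Lemma base_change_lin (K : fieldType) s : base_change K (lin rat s) = lin K s.
Proof.
apply/malgP => k; rewrite coef_base_change !coef_lin; exact: ratr_int.
Qed.

Theorem mainTheorem6 (K : fieldType) (charK : 2%N \notin [pchar K]) :
  (forall (n : nat) (w : monomial),
     (2 <= n)%N -> of_type n 2 w ->
     w <> (xbr n vy ** vy)%mg -> w <> xbr n (vy ** vy)%mg ->
     enough_scalars (mono w : freealg K) ->
     exists P : freealg rat,
       [/\ unique (is_Pw n w) P,
           coefs_in K P,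
           evanescent_train (mono w - base_change K P)
         & unique (reduced_form (mono w)) (base_change K P)])
  /\
  (forall f : freealg K,
     mspan (fun m => exists2 n : nat, (2 <= n)%N & of_type n 2 m) f ->
     enough_scalars f ->
     exists R : freealg K,
       [/\ unique (reduced_form f) R,
           f - R <> 0 -> evanescent (f - R)
         & ~ homogeneous (f - R) -> evanescent_train (f - R)]).
Proof.
have type2 (L : fieldType) (P : freealg L) :
    mspan FF P -> mspan (fun m => occ ly m = 2%N) P.
  by apply: mspanW => m; exact: occ_FF_ly.
split=> [n w n2 tw wA wB _|f f2 _]; last first.
  have fy : mspan (fun m => occ ly m = 2%N) f by apply: mspanW f2 => m [k _ []].
  have [R RFF If] := reduction_exists fy.
  have vR := idealG_vanishing If.
  exists R; split; first exact: unique_reduced_form.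
    by move=> nz; case: vR.
  by move=> nhom; apply: evanescent_train_vanishing => //; apply: mspanB => //; exact: type2.
have [wn wy] := tw.
have wFF : ~ FF w.
  case=> r wr; have er := occ_FF_lx wr; rewrite wn in er.
  by case: wr; rewrite -er.
have [s [sFF red]] := reducible_type2 wy; rewrite wn in sFF.
have linFF L : mspan FF (lin L s).
  by apply: mspanW (mspan_lin sFF) => m; exact: FF_le_FF.
have train (L : fieldType) : 2%N \notin [pchar L] -> evanescent_train (mono w - lin L s).
  move=> charL; have vs := idealG_vanishing (red L).
  apply: evanescent_train_vanishing => //.
    by apply: mspanB; [exact: mspan_mono | exact: type2].
  exact: not_homogeneous_sub tw _ _ _.
have charQ : 2%N \notin [pchar rat] by rewrite inE.
exists (lin rat s); rewrite base_change_lin; split.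
- split=> [|Q [QFF _ [_ [_ dx dy e]]]].
    split; [exact: linFF | | exact: train].
    apply/bigmax_leqP_seq => m ms _.
    by case: (mspan_lin sFF ms) => r le /occ_FF_lx->.
  exact: vanishing_sub_unique (idealG_vanishing (red _)) _.
- exact: coefs_in_lin.
- exact: train.
exact: unique_reduced_form.
Qed.
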